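(* Consider D$^2$/Exact-Diffusion for decentralized stochastic optimization with $n$ nodes, a symmetric doubly stochastic weight matrix $W$ of a strongly connected network, each $f_i$ $\mu$-strongly convex ($\mu>0$) and $L$-smooth, unbiased stochastic gradients with variance at most $\sigma^2$ independent over nodes and iterations, $\bar\lambda_n=(1+\lambda_n(W))/2$ bounded away from $0$, and the learning rate and weights $h_k$ (specified in the context) for which the algorithm has the guarantee $$\frac1{H_T}\sum_{k=0}^Th_k\big(\mathbb E f(\bar x^{(k)})-f(x^\star)\big)=\tilde O\Big(\frac{\sigma^2}{nT}+\frac{\sigma^2}{(1-\beta)T^2}+\frac1{1-\beta}\exp\{-(1-\beta)T\}\Big).$$ Then the transient stage of D$^2$/Exact-Diffusion in the strongly convex scenario is on the order of $\tilde\Omega\big(\frac n{1-\beta}\big)$.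
   Context: Problem: $f=\frac1n\sum_{i=1}^n f_i$ with $f_i(x)=\mathbb E_{\xi_i\sim D_i}F(x;\xi_i)$, $x\in\mathbb R^d$; $x^\star$ the minimizer of $f$. Eigenvalues of $W$: $1=\lambda_1(W)>\lambda_2(W)\ge\dots\ge\lambda_n(W)>-1$; $\beta=\max\{|\lambda_2(W)|,|\lambda_n(W)|\}<1$; $\bar W=(I+W)/2$; $\bar\lambda_i=(1+\lambda_i(W))/2$; $\beta_1=\bar\lambda_2^{1/2}$; $V=(I-\bar W)^{1/2}$. Algorithm: with $\mathbf x^{(k)}\in\mathbb R^{n\times d}$ having rows $(x_i^{(k)})^T$, $\mathbf x^{(0)}=\mathbf y^{(0)}=0$: $\mathbf x^{(k+1)}=\bar W(\mathbf x^{(k)}-\gamma\nabla F(\mathbf x^{(k)};\boldsymbol\xi^{(k)}))-V\mathbf y^{(k)}$, $\mathbf y^{(k+1)}=\mathbf y^{(k)}+V\mathbf x^{(k+1)}$, where the $i$-th row of $\nabla F(\mathbf x^{(k)};\boldsymbol\xi^{(k)})$ is $\nabla F(x_i^{(k)};\xi_i^{(k)})^T$; $\bar x^{(k)}=\frac1n\sum_ix_i^{(k)}$. Learning rate: $\gamma=\min\{\frac1{4L},\frac{1-\beta_1}{26L}\frac{\bar\lambda_n^{1/2}}{\bar\lambda_2},\frac{2\ln(2n\mu\mathbb E\|\bar x^{(0)}-x^\star\|^2T^2/[\sigma^2(1-\beta)])}{\mu T}\}$. Weights: $h_k>0$, $h_k=(1-\frac{\gamma\mu}2)h_{k+1}$,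 $H_T=\sum_{k=0}^Th_k$. Transient stage: the number of iterations $T$ needed to reach the linear-speedup stage, i.e. the order of the smallest $T$ from which on the term of the rate bound involving $nT$, here $\frac{\sigma^2}{nT}$, dominates the other terms of the bound up to absolute constants; the exponentially decaying term is disregarded. $\tilde O,\tilde\Omega$ hide logarithmic factors; $\sigma>0$ is treated as a constant. *)

(* Defs.v *)
From HB Require Import structures.
From mathcomp Require Import all_boot all_order all_algebra.
From mathcomp Require Import all_classical all_reals all_analysis.

Set Implicit Arguments.
Unset Strict Implicit.
Unset Printing Implicit Defensive.

Import Order.TTheory GRing.Theory Num.Theory.
Import numFieldNormedType.Exports.

Local Open Scope classical_set_scope.
Local Open Scope ring_scope.

Section Euclidean.
Variables (R : realType) (d : nat).

Definition dot (u v : 'rV[R]_d) : R := \sum_(j < d) u 0 j * v 0 j.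

(* The library norm on 'rV is the sup norm; the Euclidean one is needed here. *)
Definition norm2 (u : 'rV[R]_d) : R := Num.sqrt (dot u u).

Definition grad (f : 'rV[R]_d -> R) (x : 'rV[R]_d) : 'rV[R]_d :=
  \row_(j < d) 'D_(delta_mx 0 j) f x.

Definition strongly_convex (mu : R) (f : 'rV[R]_d -> R) : Prop :=
  (forall x, differentiable f x) /\
  forall x y, f x + dot (grad f x) (y - x) + mu / 2 * norm2 (y - x) ^+ 2 <= f y.

Definition smooth (L : R) (f : 'rV[R]_d -> R) : Prop :=
  (forall x, differentiable f x) /\
  forall x y, norm2 (grad f x - grad f y) <= L * norm2 (x - y).

End Euclidean.

Section SymmetricMatrices.
Variables (R : realType) (n : nat).

(* s lists the eigenvalues of A with multiplicity in nonincreasing order; the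
   k-th largest eigenvalue is s`_k.-1. *)
Definition spectrum_of (A : 'M[R]_n) (s : seq R) : Prop :=
  char_poly A = \prod_(a <- s) ('X - a%:P) /\ sorted >=%R s.

Definition psd_sqrt (A B : 'M[R]_n) : Prop :=
  [/\ B^T = B, forall u : 'rV[R]_n, 0 <= dot (u *m B) u & B *m B = A].

Definition doubly_stochastic (W : 'M[R]_n) : Prop :=
  [/\ forall i j, 0 <= W i j,
      forall i, \sum_(j < n) W i j = 1 &
      forall j, \sum_(i < n) W i j = 1].

(* W i j is the weight given by node i to the data received from node j. *)
Definition strongly_connected (W : 'M[R]_n) : Prop :=
  forall i j : 'I_n, connect [rel k l | 0 < W k l] i j.

End SymmetricMatrices.

Definition mutually_independent d d' (R : realType) (Omega : measurableType d)
    (S : measurableType d') (P : probability Omega R) (I : eqType)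
    (X : I -> Omega -> S) : Prop :=
  forall (s : seq I) (A : I -> set S),
    uniq s -> (forall i, measurable (A i)) ->
    P (\bigcap_(i in [set` s]) X i @^-1` A i) =
      (\prod_(i <- s) P (X i @^-1` A i))%E.

Record problem (R : realType) := Problem {
  nodes : nat;
  dim : nat;
  W : 'M[R]_nodes;
  lam : seq R;
  V : 'M[R]_nodes;
  dispS : measure_display;
  S : measurableType dispS;
  D : 'I_nodes -> probability S R;
  F : 'rV[R]_dim -> S -> R;
  (* samples: xi i k is the one drawn by node i at iteration k *)
  dispO : measure_display;
  Omega : measurableType dispO;
  Pr : probability Omega R;
  xi : 'I_nodes -> nat -> Omega -> S;
  xstar : 'rV[R]_dim;
  (* h T k is the weight of iteration k when the horizon is T; it depends on T
     because the learning rate does *)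
  h : nat -> nat -> R
}.

Arguments xi {R} p _ _ _.
Arguments F {R} p _ _.
Arguments D {R} p _.
Arguments h {R} p _ _.

Section Problem.
Variables (R : realType) (p : problem R).

Let n := nodes p.
Let d := dim p.

Definition fi (i : 'I_n) (x : 'rV[R]_d) : R :=
  \int[D p i]_s F p x s.

Definition f (x : 'rV[R]_d) : R := n%:R^-1 * \sum_(i < n) fi i x.

Definition beta : R := Num.max `|(lam p)`_1| `|(lam p)`_n.-1|.

Definition Wbar : 'M[R]_n := 2^-1 *: (1%:M + W p).

(* lambar k is (1 + lambda_k(W)) / 2, with k counted from 1. *)
Definition lambar (k : nat) : R := (1 + (lam p)`_k.-1) / 2.

Definition beta1 : R := Num.sqrt (lambar 2).

Definition row_mean (x : 'M[R]_(n, d)) : 'rV[R]_d :=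
  n%:R^-1 *: \sum_(i < n) row i x.

Definition stoch_grad (x : 'M[R]_(n, d)) (k : nat) (w : Omega p) : 'M[R]_(n, d) :=
  \matrix_(i < n) grad (fun z => F p z (xi p i k w)) (row i x).

Definition init : 'M[R]_(n, d) * 'M[R]_(n, d) := (0, 0).

(* The pair (x^(k), y^(k)) of D^2/Exact-Diffusion with step size g. *)
Fixpoint exact_diffusion (g : R) (k : nat) (w : Omega p) :
    'M[R]_(n, d) * 'M[R]_(n, d) :=
  if k is k'.+1 then
    let: (x, y) := exact_diffusion g k' w in
    let x' := Wbar *m (x - g *: stoch_grad x k' w) - V p *m y in
    (x', y + V p *m x')
  else init.

Definition xbar (g : R) (k : nat) (w : Omega p) : 'rV[R]_d :=
  row_mean (exact_diffusion g k w).1.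

Section Constants.
Variables mu L sigma : R.

Record assumptions : Prop := Assumptions {
  nodes_ge2 : (2 <= n)%N;
  dim_gt0 : (0 < d)%N;
  W_sym : (W p)^T = W p;
  W_stochastic : doubly_stochastic (W p);
  W_connected : strongly_connected (W p);
  lam_spectrum : spectrum_of (W p) (lam p);
  lam1 : (lam p)`_0 = 1;
  lam2 : (lam p)`_1 < 1;
  lamn : -1 < (lam p)`_n.-1;
  V_sqrt : psd_sqrt (1%:M - Wbar) (V p);
  F_integrable : forall i x,
    (D p i).-integrable setT (fun s => (F p x s)%:E);
  F_differentiable : forall s x, differentiable (fun z => F p z s) x;
  fi_convex : forall i, strongly_convex mu (fi i);
  fi_smooth : forall i, smooth L (fi i);
  xstar_min : forall x, f (xstar p) <= f x;
  grad_unbiased : forall i x (j : 'I_d),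
    ('E_(D p i)[fun s => (grad (fun z => F p z s) x 0 j)%R] =
       (grad (fi i) x 0 j)%:E)%E;
  grad_variance : forall i x,
    ('E_(D p i)[fun s =>
        (norm2 (grad (fun z => F p z s) x - grad (fi i) x) ^+ 2)%R]
       <= (sigma ^+ 2)%:E)%E;
  xi_measurable : forall i k, measurable_fun setT (xi p i k);
  xi_law : forall i k (A : set (S p)), measurable A ->
    Pr p (xi p i k @^-1` A) = D p i A;
  xi_indep : mutually_independent (Pr p)
    (fun ik : 'I_n * nat => xi p ik.1 ik.2)
}.

Definition learning_rate (T : nat) : R :=
  let E0 := fine 'E_(Pr p)[fun=> norm2 (row_mean init.1 - xstar p) ^+ 2] in
  Num.min ((4 * L)^-1)
   (Num.min ((1 - beta1) / (26 * L) * (Num.sqrt (lambar n) / lambar 2))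
     (2 * ln (2 * n%:R * mu * E0 * T%:R ^+ 2 / (sigma ^+ 2 * (1 - beta)))
        / (mu * T%:R))).

Definition weights_ok : Prop :=
  forall T, (0 < T)%N ->
    (forall k, (k <= T)%N -> 0 < h p T k) /\
    (forall k, (k < T)%N ->
       h p T k = (1 - learning_rate T * mu / 2) * h p T k.+1).

(* (1/H_T) sum_(k <= T) h_k (E f(xbar^(k)) - f(xstar)) *)
Definition mean_suboptimality (T : nat) : \bar R :=
  ((\sum_(0 <= k < T.+1) h p T k)^-1%R%:E *
   \sum_(0 <= k < T.+1)
     (h p T k)%:E *
     ('E_(Pr p)[fun w => f (xbar (learning_rate T) k w)] - (f (xstar p))%:E))%E.

Definition speedup_term (T : nat) : R := sigma ^+ 2 / (n%:R * T%:R).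

Definition network_term (T : nat) : R :=
  sigma ^+ 2 / ((1 - beta) * T%:R ^+ 2).

Definition decay_term (T : nat) : R :=
  (1 - beta)^-1 * expR (- ((1 - beta) * T%:R)).

End Constants.

Definition n_over_gap : R := n%:R / (1 - beta).

End Problem.

(* The factors that O~ hides in the rate bound, uniformly over the problems of
   Fam and the horizons T: between a positive constant and a polylogarithm of
   n T / (1 - beta). *)
Definition log_factor (R : realType) (Fam : problem R -> Prop)
    (l : problem R -> nat -> R) : Prop :=
  exists (c C : R) (q : nat), 0 < c /\
    forall p T, Fam p -> (0 < T)%N ->
      c <= l p T <= C * (1 + ln (n_over_gap p * T%:R)) ^+ q.

(* u is of the order of v, up to constants and polylogarithms of v that are
   uniform over the problems of Fam. *)
Definition same_order_upto_log (R : realType) (Fam : problem R -> Prop)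
    (u v : problem R -> R) : Prop :=
  exists (a b : R) (q : nat), [/\ 0 < a, 0 < b &
    forall p, Fam p ->
      a * (v p / (1 + ln (v p)) ^+ q) <= u p <= b * (v p * (1 + ln (v p)) ^+ q)].

(* K is the least positive horizon from which on lead dominates other, up to the
   constant kappa. *)
Definition transient_stage (R : realType) (kappa : R) (lead other : nat -> R)
    (K : nat) : Prop :=
  let dominates_from K' :=
    (0 < K')%N /\ forall T, (K' <= T)%N -> other T <= kappa * lead T in
  dominates_from K /\ forall K', dominates_from K' -> (K <= K')%N.

(* Main.v *)
Require Import Defs.
From HB Require Import structures.
From mathcomp Require Import all_boot all_order all_algebra.
From mathcomp Require Import all_classical all_reals all_analysis.
From mathcomp Require Import zify ring lra.

Set Implicit Arguments.
Unset Strict Implicit.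
Unset Printing Implicit Defensive.

Import Order.TTheory GRing.Theory Num.Theory.
Import numFieldNormedType.Exports.

Local Open Scope classical_set_scope.
Local Open Scope ring_scope.

(* Multiplying by [n T^2 / sigma^2] turns the domination of the network term by
   the speedup term into [l2 * v <= kappa * l1 * T] with [v = n / (1 - beta)].
   This holds as soon as [T] exceeds [v] times a large enough polylogarithm of
   [v]; conversely, at a domination time [T < v] the logarithms of [v * T] are
   at most [2 ln v], so [T] is at least [v] divided by a polylogarithm. *)

(** * Polylogarithms against linear growth *)

Section Polylogarithms.
Variable R : realType.
Implicit Types (s t v A : R) (q : nat).

Lemma ln1_ge1 v : 1 <= v -> 1 <= 1 + ln v.
Proof. by move=> v1; rewrite lerDl ln_ge0. Qed.

(** With [w = (1 + ln s) / (q + 1)], raise [w <= expR (w - 1)] to the power [q + 1]: the right side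
    becomes [expR (ln s - q)], at most [s]. *)
Lemma ln1_expn_le q s : 1 <= s ->
  (1 + ln s) ^+ q.+1 <= q.+1%:R ^+ q.+1 * s.
Proof.
move=> s1; have s0 : 0 < s by exact: lt_le_trans s1.
have u0 := le_trans ler01 (ln1_ge1 s1).
have q0 : 0 < q.+1%:R :> R by rewrite ltr0n.
set w := (1 + ln s) / q.+1%:R.
have w0 : 0 <= w by rewrite divr_ge0 // ltW.
have -> : 1 + ln s = q.+1%:R * w by rewrite /w mulrC divfK // gt_eqF.
rewrite exprMn ler_pM2l ?exprn_gt0 //.
have we : w <= expR (w - 1).
  by have := expR_ge1Dx (w - 1); rewrite addrC subrK.
apply: (le_trans (lerXn2r q.+1 _ _ we)); rewrite ?nnegrE ?expR_ge0 //.
rewrite -expRM_natl -[leRHS]lnK ?posrE // ler_expR mulrBr mulr1 /w.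
rewrite mulrC divfK ?gt_eqF // -natr1.
by have : 0 <= q%:R :> R by []; lra.
Qed.

Lemma polylog_eventually_le q A :
  exists2 B, 1 <= B & forall s, B <= s -> A * (1 + ln s) ^+ q <= s.
Proof.
set N : R := q.+1%:R ^+ q.+1.
have N0 : 0 < N by rewrite exprn_gt0 // ltr0n.
exists (expR (`|A| * N)) => [|s Bs].
  by rewrite -expR0 ler_expR mulr_ge0 // ltW.
have s1 : 1 <= s.
  by apply: le_trans Bs; rewrite -expR0 ler_expR mulr_ge0 // ltW.
have u0 := le_trans ler01 (ln1_ge1 s1).
have lnB : `|A| * N <= 1 + ln s.
  have s0 : 0 < s by exact: lt_le_trans s1.
  have : `|A| * N <= ln s by rewrite -ler_expR lnK.
  lra.
rewrite -(ler_pM2l N0); apply: le_trans (ln1_expn_le q s1).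
rewrite exprS mulrA ler_wpM2r ?exprn_ge0 //.
apply: le_trans lnB; rewrite mulrC ler_wpM2r ?ler_norm //; exact: ltW.
Qed.

(* Writing [t = s * (v * (1 + ln v) ^+ q)], the logarithm of [v * t] is at most
   [ln s + (q + 2) * ln v], so [1 + ln v] factors out and only [s] matters. *)
Lemma polylog_absorb q A :
  exists2 B, 1 <= B & forall v t, 1 <= v -> B * (v * (1 + ln v) ^+ q) <= t ->
    A * (1 + ln (v * t)) ^+ q * v <= t.
Proof.
have [B B1 HB] := polylog_eventually_le q (`|A| * q.+2%:R ^+ q).
exists B => // v t v1 Bt.
have v0 : 0 < v by exact: lt_le_trans v1.
have u1 := ln1_ge1 v1.
have u0 : 0 < 1 + ln v by exact: lt_le_trans u1.
have lnv0 : 0 <= ln v by rewrite ln_ge0.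
set m := v * (1 + ln v) ^+ q in Bt *.
have m0 : 0 < m by rewrite mulr_gt0 // exprn_gt0.
set s := t / m.
have Bs : B <= s by rewrite ler_pdivlMr.
have s1 : 1 <= s by exact: le_trans Bs.
have s0 : 0 < s by exact: lt_le_trans s1.
have lns0 : 0 <= ln s by rewrite ln_ge0.
have tE : t = s * m by rewrite divfK // gt_eqF.
(* By [ln (1 + x) <= x] at [x = ln v], the iterated logarithm costs only [q * ln v]. *)
have lnm : ln m <= q.+1%:R * ln v.
  rewrite /m lnM ?posrE ?exprn_gt0 // lnXn // -natr1 mulrDl mul1r addrC lerD2r.
  by rewrite -[leLHS]mulr_natl ler_wpM2l // le_ln1Dx // (lt_le_trans _ lnv0) ?ltrN10.
have m1 : 1 <= m by rewrite mulr_ege1 ?exprn_ege1.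
have lnle : 1 + ln (v * t) <= q.+2%:R * ((1 + ln s) * (1 + ln v)).
  have q0 : 0 <= q%:R :> R by [].
  have -> : ln (v * t) = ln v + (ln s + ln m).
    by rewrite tE (lnM v0 (mulr_gt0 s0 m0)) (lnM s0 m0).
  have p1 : 0 <= ln s * ln v by rewrite mulr_ge0.
  have p2 : 0 <= q%:R * (ln s + ln s * ln v) by rewrite mulr_ge0 // addr_ge0.
  move: lnm; rewrite -(natr1 q.+1) -(natr1 q); lra.
have ln0 : 0 <= 1 + ln (v * t).
  by rewrite addr_ge0 // ln_ge0 // mulr_ege1 // tE mulr_ege1.
apply: (@le_trans _ _ (`|A| * (q.+2%:R * ((1 + ln s) * (1 + ln v))) ^+ q * v)).
  rewrite ler_wpM2r ?(ltW v0) //.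
  apply: (@le_trans _ _ (`|A| * (1 + ln (v * t)) ^+ q)).
    by rewrite ler_wpM2r ?exprn_ge0 ?ler_norm.
  rewrite ler_wpM2l // lerXn2r // nnegrE; exact: le_trans lnle.
have -> : `|A| * (q.+2%:R * ((1 + ln s) * (1 + ln v))) ^+ q * v =
    `|A| * q.+2%:R ^+ q * (1 + ln s) ^+ q * m by rewrite !exprMn /m; ring.
by rewrite tE ler_pM2r // HB.
Qed.

End Polylogarithms.

Lemma transient_stage_exists (R : realType) (kappa : R) (lead other : nat -> R)
    (K0 : nat) :
  (0 < K0)%N -> (forall T, (K0 <= T)%N -> other T <= kappa * lead T) ->
  exists K, transient_stage kappa lead other K.
Proof.
move=> K0_gt0 dom0.
pose P K := `[< (0 < K)%N /\ forall T, (K <= T)%N -> other T <= kappa * lead T >].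
have exP : exists K, P K by exists K0; apply/asboolP.
case: (ex_minnP exP) => K /asboolP PK Kmin.
by exists K; split=> // K' PK'; apply: Kmin; apply/asboolP.
Qed.

(** * The spectral gap and the reduced form of domination *)

Section Spectrum.
Variables (R : realType) (p : problem R) (mu L sigma : R).
Hypothesis pA : assumptions p mu L sigma.

Lemma beta_ge0 : 0 <= beta p.
Proof. by rewrite le_max normr_ge0. Qed.

(** Sortedness gives [lambda_n <= lambda_2], so both lie strictly between -1 and 1. The degree of
    the characteristic polynomial gives the length of [lam p], which keeps the indices in range. *)
Lemma beta_lt1 : beta p < 1.
Proof.
have n2 := nodes_ge2 pA; have [cE sL] := lam_spectrum pA.
have sz : size (lam p) = nodes p.
  by have := size_char_poly (W p); rewrite cE size_prod_XsubC => -[].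
have le21 : (lam p)`_(nodes p).-1 <= (lam p)`_1.
  have ge_trans : transitive (>=%R : rel R) by move=> y x z; exact: ge_trans.
  apply: (sorted_leq_nth ge_trans (fun x => lexx x) 0 sL);
    rewrite ?inE ?sz; lia.
have := lam2 pA; have := lamn pA.
rewrite /beta gt_max !ltr_norml => ? ?.
by apply/andP; split; apply/andP; split; lra.
Qed.

Lemma gap_gt0 : 0 < 1 - beta p. Proof. by rewrite subr_gt0 beta_lt1. Qed.

Lemma n_over_gap_ge1 : 1 <= n_over_gap p.
Proof.
rewrite /n_over_gap ler_pdivlMr ?gap_gt0 // mul1r.
have : 2%:R <= (nodes p)%:R :> R by rewrite ler_nat (nodes_ge2 pA).
by have := beta_ge0; lra.
Qed.

(** The sides differ by the positive factor [sigma ^+ 2 / (n * T ^+ 2)]; [a] and [b] stand for the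
    values of the hidden logarithmic factors at [T]. *)
Lemma network_le_speedup (sigma_gt0 : 0 < sigma) (kappa a b : R) (T : nat) :
  (0 < T)%N ->
  (b * network_term p sigma T <= kappa * (a * speedup_term p sigma T)) =
  (b * n_over_gap p <= kappa * a * T%:R).
Proof.
move=> T0; have g0 := gap_gt0.
have t0 : 0 < T%:R :> R by rewrite ltr0n.
have n0 : 0 < (nodes p)%:R :> R by rewrite ltr0n; have := nodes_ge2 pA; lia.
have c0 : 0 < sigma ^+ 2 / ((nodes p)%:R * T%:R ^+ 2).
  by rewrite divr_gt0 ?mulr_gt0 ?exprn_gt0.
rewrite -[RHS](ler_pM2r c0) /network_term /speedup_term /n_over_gap.
congr (_ <= _); field; rewrite ?gt_eqF //.
Qed.

End Spectrum.

Theorem corollary2 (R : realType) (mu L sigma delta : R)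
    (mu_gt0 : 0 < mu) (L_gt0 : 0 < L) (sigma_gt0 : 0 < sigma)
    (delta_gt0 : 0 < delta)
    (Fam : problem R -> Prop)
    (Fam_assumptions : forall p, Fam p ->
       [/\ assumptions p mu L sigma, weights_ok p mu L sigma &
           delta <= lambar p (nodes p)])
    (l1 l2 l3 : problem R -> nat -> R)
    (l1_log : log_factor Fam l1)
    (l2_log : log_factor Fam l2)
    (l3_log : log_factor Fam l3)
    (guarantee : forall p T, Fam p -> (0 < T)%N ->
       0 < learning_rate p mu L sigma T ->
       (mean_suboptimality p mu L sigma T <=
          (l1 p T * speedup_term p sigma T + l2 p T * network_term p sigma T
             + l3 p T * decay_term p T)%:E)%E)
    (kappa : R) (kappa_gt0 : 0 < kappa) :
  exists K : problem R -> nat,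
    (forall p, Fam p ->
       transient_stage kappa
         (fun T => l1 p T * speedup_term p sigma T)
         (fun T => l2 p T * network_term p sigma T) (K p)) /\
    same_order_upto_log Fam (fun p => (K p)%:R) (@n_over_gap R).
Proof.
have [c1 [C1 [q1 [c1_gt0 l1P]]]] := l1_log.
have [c2 [C2 [q2 [c2_gt0 l2P]]]] := l2_log.
(* Worst case for domination: [l2] at its upper bound and [l1] at its lower bound. *)
have [B B1 absorb] := polylog_absorb q2 (C2 / (kappa * c1)).
(* When [K < v], [1 + ln (v * K) <= 2 * (1 + ln v)], whence [2 ^+ q1]; [|C1| + 1] is a positive
   majorant of [C1]. *)
pose M := kappa * (`|C1| + 1) * 2 ^+ q1.
have M_gt0 : 0 < M by rewrite !mulr_gt0 ?exprn_gt0 ?ltr_wpDl.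
pose a := Num.min 1 (c2 / M).
have a_gt0 : 0 < a by rewrite lt_min ltr01 divr_gt0.
pose q := (q1 + q2)%N.
(* The constants [a], [B] and [q] are fixed before [p], so the bounds are uniform over [Fam], and
   [choice] collects the stages into a function. *)
suff KP p : exists K, Fam p ->
    transient_stage kappa (fun T => l1 p T * speedup_term p sigma T)
      (fun T => l2 p T * network_term p sigma T) K /\
    a * (n_over_gap p / (1 + ln (n_over_gap p)) ^+ q) <= K%:R
      <= (B + 1) * (n_over_gap p * (1 + ln (n_over_gap p)) ^+ q).
  have [K HK] := choice KP; exists K; split=> [p /HK[]//|].
  by exists a, (B + 1), q; split=> [||p /HK[]//]; lra.
have [pF|] := pselect (Fam p); last by exists 0%N.
have [pA _ _] := Fam_assumptions p pF.
set v := n_over_gap p.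
have v1 : 1 <= v := n_over_gap_ge1 pA.
have v0 : 0 < v by exact: lt_le_trans v1.
have u1 := ln1_ge1 v1.
have u0 : 0 < 1 + ln v by exact: lt_le_trans u1.
have expu_ge1 k : 1 <= (1 + ln v) ^+ k by exact: exprn_ege1.

(* Existence of the stage and its upper bound *)
pose X := B * (v * (1 + ln v) ^+ q2).
have X1 : 1 <= X by exact: mulr_ege1 B1 (mulr_ege1 v1 (expu_ge1 q2)).
have /andP[truncX Xtrunc] := truncn_itv (le_trans ler01 X1).
pose K0 := (Num.truncn X).+1.
have dom0 T : (K0 <= T)%N ->
    l2 p T * network_term p sigma T <= kappa * (l1 p T * speedup_term p sigma T).
  move=> K0T; have T0 : (0 < T)%N by exact: leq_trans K0T.
  rewrite (network_le_speedup pA) // -/v.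
  have XT : X <= T%:R by apply: (le_trans (ltW Xtrunc)); rewrite ler_nat.
  have /andP[c1l1 _] := l1P _ _ pF T0.
  have /andP[_ l2C2] := l2P _ _ pF T0.
  apply: (@le_trans _ _ (kappa * c1 * T%:R)); last first.
    by rewrite ler_wpM2r // ler_pM2l.
  apply: (@le_trans _ _ (C2 * (1 + ln (v * T%:R)) ^+ q2 * v)).
    by rewrite ler_wpM2r // ltW.
  have kc : 0 < kappa * c1 by rewrite mulr_gt0.
  rewrite -ler_pdivrMl //; apply: le_trans (absorb _ _ v1 XT).
  by rewrite le_eqVlt; apply/orP; left; apply/eqP; ring.
have [K [[K_gt0 domK] Kmin]] :=
  transient_stage_exists (lead := fun T => l1 p T * speedup_term p sigma T)
    (other := fun T => l2 p T * network_term p sigma T) (ltn0Sn _ : (0 < K0)%N) dom0.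
exists K => _; split; first by split.
have K1 : 1 <= K%:R :> R by rewrite ler1n.
apply/andP; split; last first.
  have KK0 : (K <= K0)%N by apply: Kmin.
  apply: (@le_trans _ _ (X + 1)).
    apply: (@le_trans _ _ K0%:R); first by rewrite ler_nat.
    by rewrite /K0 -natr1 lerD2r.
  have uq : v * (1 + ln v) ^+ q2 <= v * (1 + ln v) ^+ q.
    by rewrite ler_pM2l // ler_weXn2l // leq_addl.
  (* The 1 lost in rounding [X] up to [K0] is absorbed by the second summand, a product of factors
     at least 1. *)
  rewrite mulrDl mul1r lerD //; first by rewrite ler_wpM2l //; lra.
  by rewrite mulr_ege1.

(* Lower bound on the stage *)
rewrite mulrA ler_pdivrMr ?exprn_gt0 //.
have [vK|Kv] := lerP v K%:R.
  apply: (@le_trans _ _ (1 * v)); first by rewrite ler_pM2r // ge_min lexx.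
  by rewrite mul1r; apply: (le_trans vK); rewrite ler_peMr.
(* Domination at [T = K] itself gives [c2 * v <= l2 * v <= kappa * l1 * K]; it remains to bound
   [kappa * l1] by a polylogarithm of [v]. *)
have := domK K (leqnn K); rewrite (network_le_speedup pA) // -/v => l2l1.
have /andP[_ l1C1] := l1P _ _ pF K_gt0.
have /andP[c2l2 _] := l2P _ _ pF K_gt0.
have K0' : 0 < K%:R :> R by rewrite ltr0n.
have lnvK : ln (v * K%:R) <= ln v + ln v.
  by rewrite lnM ?posrE // lerD2l ler_ln ?posrE // ltW.
have lnvK0 : 0 <= ln (v * K%:R) by rewrite ln_ge0 // mulr_ege1.
have l1M : kappa * l1 p K <= M * (1 + ln v) ^+ q1.
  rewrite /M -!mulrA ler_pM2l // -exprMn.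
  apply: (le_trans l1C1).
  apply: (@le_trans _ _ ((`|C1| + 1) * (1 + ln (v * K%:R)) ^+ q1)).
    by rewrite ler_wpM2r ?exprn_ge0 //; have := ler_norm C1; lra.
  by rewrite ler_wpM2l ?addr_ge0 // lerXn2r ?nnegrE; lra.
apply: (@le_trans _ _ (c2 / M * v)).
  by rewrite ler_pM2r // ge_min lexx orbT.
rewrite mulrAC ler_pdivrMr //.
apply: (@le_trans _ _ (l2 p K * v)); first by rewrite ler_pM2r.
apply: (le_trans l2l1).
rewrite mulrC -[leRHS]mulrA ler_pM2l // [leRHS]mulrC; apply: (le_trans l1M).
by rewrite ler_pM2l // ler_weXn2l // leq_addr.
Qed.
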